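(* Let $X$ and $Y$ be complete, separable, locally compact metric spaces with Borel $\sigma$-algebras $\mathfrak{B}_X$, $\mathfrak{B}_Y$, and let $\mathfrak{B}_{X\times Y}$ be the Borel $\sigma$-algebra of $X\times Y$. Let $c:X\times Y\to\mathbb{R}\cup\{+\infty\}$ be a $\mathfrak{B}_{X\times Y}$-measurable function (cost function), and let $\psi:X\to\mathbb{R}\cup\{+\infty\}$ and $\phi:Y\to\mathbb{R}\cup\{-\infty\}$ be a pair of competitive prices, i.e. $$\forall (x,y)\in X\times Y,\quad \phi(y)-\psi(x)\le c(x,y).$$ Let $\pi$ be a probability measure on $\mathfrak{B}_{X\times Y}$ with marginal measures $\mu$ on $\mathfrak{B}_X$ and $\nu$ on $\mathfrak{B}_Y$ (i.e. $\pi$ is a transference plan between $\mu$ and $\nu$). Assume that the functions $(x,y)\mapsto\phi(y)-\psi(x)$ and $c$ are $\pi$-integrable and that $$\phi(y)-\psi(x)=c(x,y)\quad \text{for } \pi\text{-almost every }(x,y).$$ Then $$\psi(x)=\sup_{y\in Y}\bigl(\phi(y)-c(x,y)\bigr)\quad\text{for }\mu\text{-almost every }x\in X,$$ and $$\phi(y)=\inf_{x\in X}\bigl(\psi(x)+c(x,y)\bigr)\quad\text{for }\nu\text{-almost every }y\in Y.$$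
   Context: The marginals of $\pi$ are $\mu(A)=\pi(A\times Y)$ for $A\in\mathfrak{B}_X$ and $\nu(B)=\pi(X\times B)$ for $B\in\mathfrak{B}_Y$. Arithmetic is in the extended reals; the expressions $\phi(y)-\psi(x)$, $\phi(y)-c(x,y)$ (values in $\mathbb{R}\cup\{-\infty\}$) and $\psi(x)+c(x,y)$ (values in $\mathbb{R}\cup\{+\infty\}$) are always well defined. Here $\pi$-integrability of an extended-real-valued function means that it is $\pi$-measurable with finite integral of its absolute value. *)

(* Defs.v *)
From HB Require Import structures.
From mathcomp Require Import all_boot all_order all_algebra.
From mathcomp Require Import all_classical all_reals all_analysis.
From mathcomp Require Import measurable_realfun.

Set Implicit Arguments.
Unset Strict Implicit.
Unset Printing Implicit Defensive.

Import Order.TTheory GRing.Theory Num.Theory.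
Import numFieldNormedType.Exports.

Local Open Scope classical_set_scope.
Local Open Scope ereal_scope.

(* The library's complete spaces and measurable spaces are pointed; no
   generality is lost, as only a nonempty product carries a probability. *)
#[short(type="completeMetricType")]
HB.structure Definition CompleteMetric (R : numDomainType) :=
  {T of Metric R T & Complete T}.

Definition separable_space (T : topologicalType) : Prop :=
  exists2 D : set T, countable D & dense D.

Notation borelType T := (g_sigma_algebraType (@open T)).

(* [completed_measure_extension mu] is [mu]^* restricted to its Caratheodory
   sigma-algebra, which, [mu] being finite, is the completion of the sigma-algebra
   of [T] with respect to [mu]. *)
Definition completion_integrable (d : measure_display) (T : measurableType d)
    (R : realType) (mu : probability T R) (f : T -> \bar R) : Prop :=
  (@completed_measure_extension _ _ _ mu).-integrable [set: T] f.

Definition competitive_prices (R : realType) (X Y : Type)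
    (c : X * Y -> \bar R) (psi : X -> \bar R) (phi : Y -> \bar R) : Prop :=
  [/\ forall x, psi x != -oo,
      forall y, phi y != +oo
    & forall x y, phi y - psi x <= c (x, y)].

Definition transference_plan (R : realType) (X Y : ptopologicalType)
    (pi : probability (borelType (X * Y)%type) R)
    (mu : probability (borelType X) R) (nu : probability (borelType Y) R) :
    Prop :=
  (forall A : set (borelType X), measurable A -> mu A = pi (A `*` [set: Y])) /\
  (forall B : set (borelType Y), measurable B -> nu B = pi ([set: X] `*` B)).

(* Main.v *)
(* Off a pi-null Borel set, c is finite and phi y - psi x = c (x, y), so phi y and
   psi x are finite and the suprema and infima are attained there; competitiveness
   gives the reverse inequalities everywhere. It remains to see that projecting a
   set of full pi-measure gives a set of full marginal measure, although the
   projection of a Borel set need not be Borel. Separable locally compact metric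
   spaces are sigma-compact, and finite Borel measures are inner regular for
   closed sets, so a full set contains a sigma-compact full set, whose projection
   is a countable union of compact sets, hence Borel. *)
Require Import Defs.
From HB Require Import structures.
From mathcomp Require Import all_boot all_order all_algebra.
From mathcomp Require Import all_classical all_reals all_analysis.
From mathcomp Require Import measurable_realfun borel_hierarchy.

Set Implicit Arguments.
Unset Strict Implicit.
Unset Printing Implicit Defensive.

Import Order.TTheory GRing.Theory Num.Theory.
Import numFieldNormedType.Exports.

Local Open Scope classical_set_scope.
Local Open Scope ereal_scope.

(** * Topology: countable unions of closed and of compact sets *)

Definition sigma_compact (T : topologicalType) : Prop :=
  exists2 K : (set T)^nat, (forall n, compact (K n)) & \bigcup_n K n = [set: T].

Lemma pseudometric_open_Fsigma (R : realType) (T : pseudoMetricType R)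
    (U : set T) : open U -> Fsigma U.
Proof.
(* Interiors are taken because balls need not be open here. *)
move=> oU; pose V n := \bigcup_(z in ~` U) (ball z (n.+1%:R^-1 : R))°.
exists (fun n => ~` V n) => [n|].
  by apply: open_closedC; apply: bigcup_open => z _; exact: open_interior.
apply/seteqP; split => [x Ux|x [n _ nVx]]; last first.
  apply: contrapT => nUx; apply: nVx; exists x => //.
  exact: nbhsx_ballx.
have /nbhs_ballP[e /= e0 eU] : nbhs x U by exact: open_nbhs_nbhs.
have [n] := ltr_add_invr e0; rewrite add0r => ne.
exists n => // -[z nUz] /interior_subset/ball_sym xz.
by apply: nUz; apply: eU; exact: le_ball (ltW ne) _ xz.
Qed.

(** The closed balls with centre in the countable dense set, radius [1/(n+1)] and compact closure
    form a countable family; it covers because every point has a compact neighbourhood. *)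
Lemma separable_locally_compact_sigma_compact (R : realType)
    (T : pseudoMetricType R) :
  separable_space T -> locally_compact [set: T] -> sigma_compact T.
Proof.
move=> [D cD dD] lcT.
pose B (z : T * nat) := closure (ball z.1 (z.2.+1%:R^-1 : R)).
pose I := [set z : T * nat | D z.1 /\ compact (B z)].
have cI : countable I.
  apply: sub_countable (countableX cD (@countableP _ [set: nat])).
  by apply: subset_card_le => z [].
have covI : \bigcup_(z in I) B z = [set: T].
  apply/seteqP; split => // x _.
  have [K wK [cK clK]] := lcT x Logic.I.
  have {}wK : \forall y \near x, [set: T] y -> K y by exact: wK.
  have /nbhs_ballP[e /= e0 eK] : nbhs x K by apply: filterS wK => y /(_ Logic.I).
  (* Below [e / 2], so that the ball about a dense point [d] near [x] stays in the [e]-ball about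
     [x], hence in [K]. *)
  have [n] := ltr_add_invr (divr_gt0 e0 (@ltr0Sn R 1)); rewrite add0r => ne.
  have [d [/interior_subset xd Dd]] : (ball x (n.+1%:R^-1 : R))° `&` D !=set0.
    apply: dD; last exact: open_interior.
    by exists x; exact: nbhsx_ballx.
  exists (d, n); last by apply: subset_closure; exact: ball_sym.
  split => //; apply: subclosed_compact cK _; first exact: closed_closure.
  rewrite [X in _ `<=` X](closure_id _).1//; apply: closureS.
  apply: subset_trans eK => y dy; rewrite (splitr e).
  by apply: (@ball_triangle _ _ d); apply: le_ball (ltW ne) _ _.
(* If [I] is empty, so is [T]; otherwise [f] enumerates [I]. *)
have [I0|[f]] := pfcard_geP cI.
  exists (fun=> set0) => [n|]; first exact: compact0.
  by rewrite bigcup0// -covI I0 bigcup_set0.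
exists (B \o f) => [n|].
  by have [] : I (f n) by exact: funS.
by rewrite -covI -[in RHS](image_eq f) bigcup_image.
Qed.

Lemma sigma_compact_prod (S T : topologicalType) :
  sigma_compact S -> sigma_compact T -> sigma_compact (S * T)%type.
Proof.
move=> [K cK covK] [L cL covL].
exists (fun n => if unpickle n is Some p then K p.1 `*` L p.2 else set0) => [n|].
  by case: unpickle => [p|]; [exact: compact_setX|exact: compact0].
apply/seteqP; split => // -[s t] _.
have [i _ Ks] : (\bigcup_n K n) s by rewrite covK.
have [j _ Lt] : (\bigcup_n L n) t by rewrite covL.
by exists (pickle (i, j)); rewrite ?pickleK.
Qed.

Lemma borel_closed_measurable (T : ptopologicalType) (F : set (borelType T)) :
  closed (F : set T) -> measurable F.
Proof.
move=> cF; rewrite -(setCK F); apply: measurableC.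
by apply: sub_sigma_algebra; exact: closed_openC.
Qed.

(** * Inner regularity of finite Borel measures for closed sets *)

Section inner_regularity.
Context (R : realType) (T : pseudoPMetricType R)
  (P : {finite_measure set (borelType T) -> \bar R}%R).
Implicit Types (A F : set (borelType T)) (e : R).

(** Measurability is bundled in because the closure properties below estimate the measures of
    differences. *)
Definition closed_inner_regular A := measurable A /\
  forall e, (0 < e)%R -> exists F,
    [/\ closed (F : set T), F `<=` A & P (A `\` F) <= e%:E].

Lemma closed_closed_inner_regular F :
  closed (F : set T) -> closed_inner_regular F.
Proof.
move=> cF; split=> [|e e0]; first exact: borel_closed_measurable.
by exists F; split => //; rewrite setDv measure0 lee_fin ltW.
Qed.

Lemma closed_approximations (A : (set (borelType T))^nat) e :
  (forall n, closed_inner_regular (A n)) -> (0 < e)%R ->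
  exists F : (set (borelType T))^nat,
    [/\ forall n, closed (F n : set T), forall n, F n `<=` A n &
        P (\bigcup_n (A n `\` F n)) <= e%:E].
Proof.
move=> rA e0.
have /choice[F FP] n : exists F, [/\ closed (F : set T), F `<=` A n &
    P (A n `\` F) <= (e / (2 ^ n.+1)%:R)%:E].
  by have [_] := rA n; apply; rewrite divr_gt0// ltr0n expn_gt0.
have mAF n : measurable (A n `\` F n).
  apply: measurableD; first by have [] := rA n.
  by apply: borel_closed_measurable; have [] := FP n.
exists F; split=> [n|n|]; try by have [] := FP n.
apply: le_trans (epsilon_trick0 xpredT (ltW e0)).
apply: le_trans (measure_sigma_subadditive _ mAF _ _) _ => //.
  exact: bigcupT_measurable.
by apply: lee_nneseries => // n _; have [] := FP n.
Qed.

Lemma closed_inner_regular_bigcap (A : (set (borelType T))^nat) :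
  (forall n, closed_inner_regular (A n)) -> closed_inner_regular (\bigcap_n A n).
Proof.
move=> rA; have mA : measurable (\bigcap_n A n).
  by apply: bigcapT_measurable => n; have [] := rA n.
split=> // e /(closed_approximations rA)[F [cF FA AFe]].
have cFF : closed (\bigcap_n F n : set T) by exact: closed_bigI.
exists (\bigcap_n F n); split=> //; first by move=> x Fx n _; exact/FA/Fx.
apply: le_trans AFe; apply: le_measure; rewrite ?inE.
- by apply: measurableD => //; exact: borel_closed_measurable.
- apply: bigcupT_measurable => n; apply: measurableD; first by have [] := rA n.
  exact: borel_closed_measurable.
- move=> x [Ax /existsNP[n /not_implyP[_ nFx]]].
  by exists n => //; split => //; exact: Ax.
Qed.

(* The union of closed approximations need not be closed, but by
   continuity from above a finite subunion leaves a small error. *)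
Lemma closed_inner_regular_bigcup (A : (set (borelType T))^nat) :
  (forall n, closed_inner_regular (A n)) -> closed_inner_regular (\bigcup_n A n).
Proof.
move=> rA; have mA : measurable (\bigcup_n A n).
  by apply: bigcupT_measurable => n; have [] := rA n.
split=> // e e0.
(* Half of [e] keeps the limit strictly below [e], as is needed to bound some term of the sequence
   by [e]. *)
have [F [cF FA AFe]] := closed_approximations rA (divr_gt0 e0 (@ltr0Sn R 1)).
have mF n : measurable (F n) by exact: borel_closed_measurable.
pose G n := \big[setU/set0]_(i < n) F i.
have mG n : measurable (G n) by exact: bigsetU_measurable.
pose D n := \bigcup_n A n `\` G n.
have mD n : measurable (D n) by exact: measurableD.
have mDD : measurable (\bigcap_n D n) by exact: bigcapT_measurable.
have : P \o D @ \oo --> P (\bigcap_n D n).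
  apply: nonincreasing_cvg_mu => //.
    by rewrite -ge0_fin_numE// fin_num_measure.
  move=> m n mn; apply/subsetPset; apply: setDS.
  exact: subset_bigsetU.
have PDe : P (\bigcap_n D n) < e%:E.
  apply: (@le_lt_trans _ _ (e / 2)%:E); last first.
    by rewrite lte_fin ltr_pdivrMr// ltr_pMr// ltr1n.
  apply: le_trans AFe; apply: le_measure; rewrite ?inE//.
    apply: bigcupT_measurable => n; apply: measurableD => //.
    by have [] := rA n.
  move=> x Dx; have [[n _ Anx] _] := Dx 0%N I.
  exists n => //; split=> // Fnx.
  (* [G n] stops before index [n], so [F n] first enters at [G n.+1]. *)
  have [_] := Dx n.+1 I; apply; rewrite /G -bigcup_mkord.
  by exists n => /=.
move=> /(_ [set u | u < e%:E])[|N _ /(_ N (leqnn N)) /= DNe].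
  by apply: open_nbhs_nbhs; split=> //; exact: open_ereal_lt_ereal.
exists (G N); split; last exact: ltW.
  by apply: closed_bigsetU => i _; exact: cF.
rewrite /G -bigcup_mkord; move=> x [n _ /FA]; by exists n.
Qed.

(** Regularity is not evidently stable under complement, so the class [S] asks for it on both sides;
    complements of unions then call for the intersection lemma. Open sets enter as countable unions
    of closed sets. *)
Lemma borel_closed_inner_regular A : measurable A -> closed_inner_regular A.
Proof.
pose S := [set A | closed_inner_regular A /\ closed_inner_regular (~` A)].
suff sub : <<s @open T >> `<=` S by move=> /sub[].
apply: smallest_sub.
  split=> [|B [rB rCB]|B rB].
  - split; apply: closed_closed_inner_regular; first exact: closed0.
    by rewrite setC0; exact: closedT.
  - by rewrite setTD; split=> //; rewrite setCK.
  - split; first by apply: closed_inner_regular_bigcup => n; have [] := rB n.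
    rewrite setC_bigcup; apply: closed_inner_regular_bigcap => n.
    by have [] := rB n.
move=> U oU; split; last first.
  by apply: closed_closed_inner_regular; exact: open_closedC.
have [F cF ->] := pseudometric_open_Fsigma oU.
by apply: closed_inner_regular_bigcup => n; exact: closed_closed_inner_regular.
Qed.

End inner_regularity.

Lemma sigma_compact_image_negligible (R : realType) (T : pseudoPMetricType R)
    (U : ptopologicalType) (P : {finite_measure set (borelType T) -> \bar R}%R)
    (Q : {measure set (borelType U) -> \bar R}%R) (f : T -> U) (G : set T) :
  sigma_compact T -> hausdorff_space U -> continuous f ->
  (forall B : set (borelType U), measurable B -> Q B = P (f @^-1` B)) ->
  P.-negligible (~` G : set (borelType T)) ->
  Q.-negligible (~` (f @` G) : set (borelType U)).
Proof.
move=> [K cK covK] hU cf QE [N [mN PN subN]].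
have mCN : measurable (~` N) by exact: measurableC.
have [_ rN] := borel_closed_inner_regular P mCN.
have /choice[F FP] n : exists F : set T, [/\ closed F, F `<=` ~` N &
    P (~` N `\` F) <= (n.+1%:R^-1)%:E] by exact: rN.
pose C n m := F n `&` K m.
have cC n m : closed (f @` C n m).
  apply: compact_closed => //; apply: continuous_compact.
    exact: continuous_subspaceT.
  by rewrite /C setIC; apply: compact_closedI => //; have [] := FP n.
pose B : set (borelType U) := \bigcup_n \bigcup_m f @` C n m.
have mB : measurable B.
  by do 2![apply: bigcupT_measurable => ?]; exact: borel_closed_measurable.
have mfB : measurable (f @^-1` B : set (borelType T)).
  rewrite preimage_bigcup; apply: bigcupT_measurable => n.
  rewrite preimage_bigcup; apply: bigcupT_measurable => m.
  by apply: borel_closed_measurable; apply: closed_comp => // x _; exact: cf.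
exists (~` B); split; first exact: measurableC.
  rewrite QE; last exact: measurableC.
  rewrite preimage_setC; apply/eqP; rewrite eq_le measure_ge0 andbT.
  apply/lee_addgt0Pr => e e0; rewrite add0e.
  have [n] := ltr_add_invr e0; rewrite add0r => /ltW ne.
  have [cFn _ PFn] := FP n.
  have mFn := @borel_closed_measurable T (F n) cFn.
  apply: (@le_trans _ _ (P (~` N `\` F n))); last first.
    by apply: le_trans PFn _; rewrite lee_fin.
  rewrite -[leRHS]add0e -[X in _ <= X + _]PN.
  apply: le_trans (measureU2 _ _ _); rewrite ?inE//; last exact: measurableD.
  apply: le_measure; rewrite ?inE//.
  - exact: measurableC.
  - by apply: measurableU => //; exact: measurableD.
  - move=> x nBx; have [Nx|nNx] := pselect (N x); [by left|right; split=> // Fx].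
    have [m _ Kx] : (\bigcup_m K m) x by rewrite covK.
    by apply: nBx; exists n => //; exists m => //; exists x.
apply: subsetC => y [n _ [m _ [x [Fx _] <-]]].
exists x => //; apply: contrapT => /subN.
by have [_ + _] := FP n; exact.
Qed.

(* Makes a product of pointed pseudometric spaces such a space. *)
HB.saturate prod.

(** Integrability only gives an exceptional set null for the completion; as [f] is measurable for
    the original sigma-algebra, its non-finite set is measurable there, and the outer measure agrees
    with [P] on it. *)
Lemma completion_integrable_ae_fin_num (d : measure_display)
    (T : measurableType d) (R : realType) (P : probability T R)
    (f : T -> \bar R) :
  measurable_fun [set: T] f -> completion_integrable P f ->
  \forall x \ae P, f x \is a fin_num.
Proof.
move=> mf /(integrable_ae measurableT)[N [mN PN subN]].
have mfin : measurable [set x | f x \is a fin_num].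
  by rewrite -[X in measurable X]setTI; exact: emeasurable_fin_num.
apply/negligibleP; first exact: measurableC.
apply/eqP; rewrite eq_le measure_ge0 andbT.
apply: le_trans (_ : (P^* (~` [set x | f x \is a fin_num]))%mu <= 0).
  by rewrite measurable_mu_extE//; exact: measurableC.
rewrite -PN; apply: le_outer_measure; apply: subset_trans subN => x /= nfx.
by move=> /(_ I).
Qed.

Theorem lemma4p1 (R : realType) (X Y : completeMetricType R)
    (sepX : separable_space X) (sepY : separable_space Y)
    (lcX : locally_compact [set: X]) (lcY : locally_compact [set: Y])
    (c : X * Y -> \bar R) (c_neqNy : forall z, c z != -oo)
    (mc : measurable_fun [set: borelType (X * Y)%type] c)
    (psi : X -> \bar R) (phi : Y -> \bar R)
    (prices : competitive_prices c psi phi)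
    (pi : probability (borelType (X * Y)%type) R)
    (mu : probability (borelType X) R) (nu : probability (borelType Y) R)
    (plan : transference_plan pi mu nu)
    (int_prices : completion_integrable pi (fun z => phi z.2 - psi z.1))
    (int_c : completion_integrable pi c)
    (prices_eq : \forall z \ae pi, phi z.2 - psi z.1 = c z) :
  (\forall x \ae mu, psi x = ereal_sup [set phi y - c (x, y) | y in [set: Y]]) /\
  (\forall y \ae nu, phi y = ereal_inf [set psi x + c (x, y) | x in [set: X]]).
Proof.
have [psiNy phiy pr] := prices; have [muE nuE] := plan.
pose G := [set z : X * Y | phi z.2 - psi z.1 = c z /\ c z \is a fin_num].
have nG : pi.-negligible (~` G : set (borelType (X * Y)%type)).
  have := negligibleU prices_eq (completion_integrable_ae_fin_num mc int_c).
  by rewrite -setCI.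
have XYsc : sigma_compact (X * Y)%type.
  by apply: sigma_compact_prod; exact: separable_locally_compact_sigma_compact.
(* With [psi] never [-oo] and [phi] never [+oo], an infinite price would make the difference
   [-oo]. *)
have fin z : G z -> phi z.2 \is a fin_num /\ psi z.1 \is a fin_num.
  move=> [<-]; have := psiNy z.1; have := phiy z.2.
  by case: (phi z.2) (psi z.1) => [a| |] [b| |].
split.
- have muP (B : set (borelType X)) : measurable B -> mu B = pi (fst @^-1` B).
    by move=> mB; rewrite muE// setXT.
  have : mu.-negligible (~` (fst @` G) : set (borelType X)).
    apply: sigma_compact_image_negligible XYsc _ _ muP nG.
      exact: metric_hausdorff.
    by move=> z; exact: cvg_fst.
  apply: negligibleS.
  apply: subsetC => _ [[x y] /[dup] Gz [zE cfin] <-] /=.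
    have [/= phifin psifin] := fin _ Gz.
    apply/eqP; rewrite eq_le; apply/andP; split.
      apply: ereal_sup_ubound; exists y => //.
      by rewrite -zE /= -(fineK phifin) -(fineK psifin) -!EFinB subKr.
    apply: ge_ereal_sup => _ [y' _ <-].
    (* If [phi y'] is [-oo] or the cost is [+oo], the difference is [-oo]; otherwise all terms are
       real and competitiveness rearranges. *)
    have := pr x y'; have := phiy y'; have := c_neqNy (x, y').
    rewrite -(fineK psifin).
    case: (phi y') (c (x, y')) => [a| |] [b| |] //= _ _;
      rewrite ?addeNy ?addNye ?leNye//.
    by rewrite -!EFinB !lee_fin !lerBlDr addrC.
- have nuP (B : set (borelType Y)) : measurable B -> nu B = pi (snd @^-1` B).
    by move=> mB; rewrite nuE// setTX.
  have : nu.-negligible (~` (snd @` G) : set (borelType Y)).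
    apply: sigma_compact_image_negligible XYsc _ _ nuP nG.
      exact: metric_hausdorff.
    by move=> z; exact: cvg_snd.
  apply: negligibleS.
  apply: subsetC => _ [[x y] /[dup] Gz [zE cfin] <-] /=.
    have [/= phifin psifin] := fin _ Gz.
    apply/eqP; rewrite eq_le; apply/andP; split; last first.
      apply: ereal_inf_lbound; exists x => //.
      by rewrite -zE /= addeC subeK.
    apply: le_ereal_inf_tmp => _ [x' _ <-].
    (* Dually, an infinite [psi x'] or cost makes the sum [+oo]. *)
    have := pr x' y; have := psiNy x'; have := c_neqNy (x', y).
    rewrite -(fineK phifin).
    case: (psi x') (c (x', y)) => [a| |] [b| |] //= _ _;
      rewrite ?addey ?addye ?leey//.
    by rewrite -EFinB -EFinD !lee_fin lerBlDr addrC.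
Qed.
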